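(* Let $\dot{\mathrm{x}}=f(\mathrm{x},\mathrm{u})$, $\mathrm{x}(t)\in\mathbb{R}^n$, $\mathrm{u}(t)\in\mathbb{R}^m$, be a control system for which a feedback control law $u=k(x)$ has been designed that renders the closed loop homogeneous of degree $\zeta$ with respect to the standard dilation $\delta^r_\lambda$. Let $c>0$. Then the inter-execution times $\tau$ implicitly defined by the execution rule $|\mathrm{e}|=c|\mathrm{x}|$ scale according to $$\tau\big(\delta^r_\lambda(x)\big)=\lambda^{-\zeta}\,\tau(x)\qquad\text{for all }\lambda>0\text{ and all }x\in\mathbb{R}^n.$$
   Context: All objects are smooth; $|\cdot|$ is the Euclidean norm. Dilations: for $r=(r_1,\dots,r_n)$ with $r_i\ge 0$ and $\lambda>0$, the dilation map is $\delta^r_\lambda(x)=(\lambda^{r_1}x_1,\dots,\lambda^{r_n}x_n)$. It is called standard if $r_1=\dots=r_n$. In a standard dilation the same scalar exponent is used for all coordinates, and $\delta^r_\lambda$ also denotes the corresponding dilation of $\mathbb{R}^n\times\mathbb{R}^n$, $\delta^r_\lambda(x,e)=(\delta^r_\lambda(x),\delta^r_\lambda(e))$. A map $F:\mathbb{R}^N\to\mathbb{R}^N$ is homogeneous of degree $\zeta$ with respect to the dilation $\delta^r_\lambda$ if $F(\delta^r_\lambda(z))=\lambda^\zeta\delta^r_\lambda(F(z))$ for all $\lambda>0$ and all $z$, where $\zeta>-\min_i r_i$. Sample-and-hold implementation: the state is sampled at times $t_i$ and the input is held at $k(\mathrm{x}(t_i))$ until $t_{i+1}$. The measurement error is $\mathrm{e}(t)=\mathrm{x}(t_i)-\mathrm{x}(t)$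 on $[t_i,t_{i+1}[$, so that $\mathrm{e}(t_i)=0$ and the closed loop is $\dot{\mathrm{x}}=f(\mathrm{x},k(\mathrm{x}+\mathrm{e}))$, $\dot{\mathrm{e}}=-f(\mathrm{x},k(\mathrm{x}+\mathrm{e}))$. ''The closed loop is homogeneous'' means that the vector field $Z(x,e)=(f(x,k(x+e)),-f(x,k(x+e)))$ on $\mathbb{R}^{2n}$ is homogeneous. Inter-execution time: $\tau(x)$ is the first time $t\ge 0$ at which $|\mathrm{e}(t)|=c|\mathrm{x}(t)|$ along the solution of the closed loop with $(\mathrm{x}(0),\mathrm{e}(0))=(x,0)$ (with value $+\infty$ if there is no such time). *)

(* Defs.v *)
From HB Require Import structures.
From mathcomp Require Import all_boot all_order all_algebra.
From mathcomp Require Import all_classical all_reals all_analysis.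

Set Implicit Arguments.
Unset Strict Implicit.
Unset Printing Implicit Defensive.

Import Order.TTheory GRing.Theory Num.Theory.
Import numFieldNormedType.Exports.

Local Open Scope classical_set_scope.
Local Open Scope ring_scope.

(* The library norm on 'rV[R]_n is the sup norm. *)
Definition enorm (R : realType) (n : nat) (x : 'rV[R]_n) : R :=
  Num.sqrt (\sum_i (x 0 i) ^+ 2).

(* C^k through iterated directional derivatives; in finite dimension, the
   existence and continuity of all directional derivatives up to order k is
   equivalent to that of all partial derivatives up to order k. *)
Fixpoint Ck (R : realType) (U V : normedModType R) (k : nat) (f : U -> V)
    : Prop :=
  if k is k'.+1 then
    [/\ continuous f, forall z v, derivable f z v
      & forall v, Ck k' (fun z => 'D_v f z)]
  else continuous f.

Definition smooth (R : realType) (U V : normedModType R) (f : U -> V) : Prop :=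
  forall k, Ck k f.

Definition dilation (R : realType) (n : nat) (r : 'rV[R]_n) (lambda : R)
    (x : 'rV[R]_n) : 'rV[R]_n :=
  \row_i (lambda `^ r 0 i * x 0 i).

Definition standard (R : realType) (n : nat) (r : 'rV[R]_n) : Prop :=
  forall i j, r 0 i = r 0 j.

(* The first conjunct is zeta > - min_i r_i. *)
Definition homogeneous (R : realType) (n : nat) (r : 'rV[R]_n) (zeta : R)
    (F : 'rV[R]_n -> 'rV[R]_n) : Prop :=
  (forall i, - r 0 i < zeta) /\
  forall (lambda : R) (z : 'rV[R]_n), 0 < lambda ->
    F (dilation r lambda z) = lambda `^ zeta *: dilation r lambda (F z).

(* R^n x R^n is represented by 'rV_(n + n), the pair (x, e) by row_mx x e; the
   dilation (x, e) |-> (dilation r l x, dilation r l e) is then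
   dilation (row_mx r r) l. *)
Definition closed_loop (R : realType) (n m : nat)
    (f : 'rV[R]_n -> 'rV[R]_m -> 'rV[R]_n) (k : 'rV[R]_n -> 'rV[R]_m)
    (z : 'rV[R]_(n + n)) : 'rV[R]_(n + n) :=
  let x := lsubmx z in let e := rsubmx z in
  row_mx (f x (k (x + e))) (- f x (k (x + e))).

Definition solution (R : realType) (N : nat) (F : 'rV[R]_N -> 'rV[R]_N)
    (z0 : 'rV[R]_N) (T : R) (z : R -> 'rV[R]_N) : Prop :=
  [/\ z 0 = z0, {within `[0, T], continuous z}
    & forall t, t \in `]0, T[ -> is_derive t (1 : R) z (F (z t))].

Definition triggers (R : realType) (n : nat) (c : R) (z : 'rV[R]_(n + n))
    : Prop :=
  enorm (rsubmx z) = c * enorm (lsubmx z).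

(* The solution is only required to exist up to time t, so that finite escape
   times are covered. *)
Definition first_trigger_time (R : realType) (n m : nat)
    (f : 'rV[R]_n -> 'rV[R]_m -> 'rV[R]_n) (k : 'rV[R]_n -> 'rV[R]_m) (c : R)
    (x : 'rV[R]_n) (t : R) : Prop :=
  0 <= t /\
  exists z : R -> 'rV[R]_(n + n),
    [/\ solution (closed_loop f k) (row_mx x 0) t z, triggers c (z t)
      & forall s, 0 <= s < t -> ~ triggers c (z s)].

(* For smooth f and k, uniqueness of solutions gives at most one first trigger
   time; the infimum is that time if it exists and +oo otherwise. *)
Definition inter_execution_time (R : realType) (n m : nat)
    (f : 'rV[R]_n -> 'rV[R]_m -> 'rV[R]_n) (k : 'rV[R]_n -> 'rV[R]_m) (c : R)
    (x : 'rV[R]_n) : \bar R :=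
  ereal_inf [set t%:E | t in first_trigger_time f k c x].

(* Main.v *)
Require Import Defs.
From mathcomp Require Import all_boot all_order all_algebra.
From mathcomp Require Import all_classical all_reals all_analysis.
Import Order.TTheory GRing.Theory Num.Theory.
Import numFieldNormedType.Exports.
Local Open Scope classical_set_scope.
Local Open Scope ring_scope.

Set Implicit Arguments.
Unset Strict Implicit.
Unset Printing Implicit Defensive.

(** A standard dilation multiplies all coordinates by a single scalar [a], so
    [triggers] is invariant under it, and if [z] solves the closed loop then so
    does [s |-> a *: z (mu * s)] with [mu = lambda `^ zeta]. Hence every trigger
    time [t] for [x] yields the trigger time [t / mu] for the dilated point;
    applying this to [lambda^-1] as well gives both inequalities. *)

Lemma enormZ (R : realType) (n : nat) (a : R) (x : 'rV[R]_n) :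
  enorm (a *: x) = `|a| * enorm x.
Proof.
rewrite /enorm -sqrtr_sqr -sqrtrM ?sqr_ge0// mulr_sumr; congr Num.sqrt.
by apply: eq_bigr => i _; rewrite mxE exprMn.
Qed.

Lemma triggersZ (R : realType) (n : nat) (c a : R) (z : 'rV[R]_(n + n)) :
  a != 0 -> triggers c (a *: z) <-> triggers c z.
Proof.
move=> a0; rewrite /triggers !linearZ/= !enormZ mulrCA.
by split=> [|->//]; apply: mulfI; rewrite normr_eq0.
Qed.

(* The existential covers [n = 0], where [standard] provides no exponent. *)
Lemma standardP (R : realType) (n : nat) (r : 'rV[R]_n) :
  standard r -> exists rho, r = const_mx rho.
Proof.
case: n r => [|n] r rE; first by exists 0; apply/rowP; case.
by exists (r 0 ord0); apply/rowP => i; rewrite mxE; exact: rE.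
Qed.

Lemma dilation_const (R : realType) (n : nat) (rho lambda : R) (x : 'rV[R]_n) :
  dilation (const_mx rho) lambda x = lambda `^ rho *: x.
Proof. by apply/rowP => i; rewrite !mxE. Qed.

Lemma is_derive_comp_mulr (R : realType) (V : normedModType R) (z : R -> V)
    (mu s : R) (dz : V) :
  is_derive (mu * s) 1 z dz -> is_derive s 1 (fun u => z (mu * u)) (mu *: dz).
Proof.
move=> [/derivable1_diffP z_diff zE].
have mul_diff : is_diff s ( *%R mu) ( *%R mu).
  exact: (is_diffZ mu (is_diff_id s)).
have comp_diff := is_diff_comp mul_diff (differentiableP z_diff).
apply: DeriveDef; first by apply/derivable1_diffP; exact: ex_diff.
rewrite deriveE; last exact: ex_diff.
(* The increment [mu * 1] is read as the scaled vector [mu *: 1], so linearity of the differential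
   pulls [mu] out of the chain rule. *)
rewrite (@diff_val _ _ _ _ _ _ _ comp_diff)/= mulr1 -[X in 'd _ _ X]mulr1.
by rewrite -[mu * 1]/(mu *: (1 : R)) linearZ/= -deriveE// zE.
Qed.

Lemma within_continuous_comp_mulr (R : realType) (V : normedModType R)
    (z : R -> V) (mu T : R) : 0 < mu ->
  {within `[0, T], continuous z} ->
  {within `[0, mu^-1 * T], continuous (fun s => z (mu * s))}.
Proof.
move=> mu0 /subspace_continuousP z_cont; apply/subspace_continuousP => s.
(* Multiplication by [mu] respects the two intervals, so continuity relative to [[0, T]] can be
   pulled back. *)
have in_scaled u : u \in `[0, mu^-1 * T] -> mu * u \in `[0, T].
  by rewrite !in_itv/= ler_pdivlMl// => /andP[u0 ->]; rewrite mulr_ge0// ltW.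
move=> /in_scaled/z_cont; apply: cvg_comp => A.
rewrite /within/= => A_near.
have mul_cont : {for s, continuous ( *%R mu)} by exact: mulrl_continuous.
apply: (@filterS _ (nbhs s) _ _ _ _ (mul_cont _ A_near)) => u /= Au /in_scaled.
exact: Au.
Qed.

(** The chain rule contributes the factor [mu] and the scaling in space the factor [a]; homogeneity
    of [F] supplies exactly their product. *)
Lemma solution_rescale (R : realType) (N : nat) (F : 'rV[R]_N -> 'rV[R]_N)
    (a mu T : R) (z0 : 'rV[R]_N) (z : R -> 'rV[R]_N) :
  0 < mu -> (forall v, F (a *: v) = (mu * a) *: F v) ->
  solution F z0 T z ->
  solution F (a *: z0) (mu^-1 * T) (fun s => a *: z (mu * s)).
Proof.
move=> mu0 F_homog [z_init z_cont z_derive]; split.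
- by rewrite mulr0 z_init.
- move=> s; apply: cvgZr.
  exact: (within_continuous_comp_mulr mu0 z_cont).
- move=> s; rewrite in_itv/= ltr_pdivlMl// => /andP[s0 sT].
  rewrite F_homog mulrC -scalerA.
  apply/is_deriveZ/is_derive_comp_mulr/z_derive.
  by rewrite in_itv/= sT mulr_gt0.
Qed.

Section scaling.
Context (R : realType) (n m : nat).
Context (f : 'rV[R]_n -> 'rV[R]_m -> 'rV[R]_n) (k : 'rV[R]_n -> 'rV[R]_m).
Context (c : R).

Lemma first_trigger_time_rescale (a mu : R) (x : 'rV[R]_n) (t : R) :
  a != 0 -> 0 < mu ->
  (forall v, closed_loop f k (a *: v) = (mu * a) *: closed_loop f k v) ->
  first_trigger_time f k c x t ->
  first_trigger_time f k c (a *: x) (mu^-1 * t).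
Proof.
move=> a0 mu0 F_homog [t0 [z [z_sol z_trig z_first]]].
split; first by rewrite mulr_ge0// invr_ge0 ltW.
exists (fun s => a *: z (mu * s)); split.
(* The error starts at [0 = a *: 0], so the whole initial state is scaled by [a]. *)
- rewrite -[X in row_mx _ X](scaler0 _ a) -scale_row_mx.
  exact: solution_rescale.
- by apply/triggersZ => //; rewrite mulVKf// gt_eqF.
- move=> s /andP[s0]; rewrite ltr_pdivlMl// => st /triggersZ.
  by move=> /(_ a0); apply: z_first; rewrite st mulr_ge0// ltW.
Qed.

Lemma inter_execution_time_rescale_le (a mu : R) (x : 'rV[R]_n) :
  a != 0 -> 0 < mu ->
  (forall v, closed_loop f k (a *: v) = (mu * a) *: closed_loop f k v) ->
  (inter_execution_time f k c (a *: x) <=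
   mu^-1%:E * inter_execution_time f k c x)%E.
Proof.
(* Moving [mu] to the left leaves a bare infimum on the right, so it suffices to bound each trigger
   time; with no trigger time the infimum is [+oo]. *)
move=> a0 mu0 F_homog; rewrite lee_pdivlMl//.
apply/ereal_infP => _ [t t_first <-]; rewrite -lee_pdivlMl//.
apply: ereal_inf_lbound; exists (mu^-1 * t) => //.
exact: first_trigger_time_rescale.
Qed.

Lemma inter_execution_time_rescale (a mu : R) (x : 'rV[R]_n) :
  a != 0 -> 0 < mu ->
  (forall v, closed_loop f k (a *: v) = (mu * a) *: closed_loop f k v) ->
  inter_execution_time f k c (a *: x) =
  (mu^-1%:E * inter_execution_time f k c x)%E.
Proof.
move=> a0 mu0 F_homog; apply/eqP; rewrite eq_le.
rewrite inter_execution_time_rescale_le//= lee_pdivrMl//.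
(* The reverse inequality is the previous lemma at the point [a *: x] with the factors [a^-1] and
   [mu^-1]. *)
rewrite -[x in leLHS](scalerK a0) -[mu in leRHS]invrK.
apply: inter_execution_time_rescale_le; rewrite ?invr_neq0 ?invr_gt0// => v.
(* Homogeneity for the inverse factors: apply the given one at [a^-1 *: v] and divide by
   [mu * a]. *)
have mua0 : mu * a != 0 by rewrite mulf_neq0// gt_eqF.
rewrite -invfM; apply: (canRL (scalerK mua0)).
by rewrite -F_homog scalerKV.
Qed.

End scaling.

Theorem theorem4p3 (R : realType) (n m : nat)
    (f : 'rV[R]_n -> 'rV[R]_m -> 'rV[R]_n) (k : 'rV[R]_n -> 'rV[R]_m)
    (r : 'rV[R]_n) (zeta c : R) :
  smooth (fun p : 'rV[R]_n * 'rV[R]_m => f p.1 p.2) ->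
  smooth k ->
  (forall i, 0 <= r 0 i) ->
  standard r ->
  homogeneous (row_mx r r) zeta (closed_loop f k) ->
  0 < c ->
  forall (lambda : R) (x : 'rV[R]_n), 0 < lambda ->
    inter_execution_time f k c (dilation r lambda x) =
    ((lambda `^ (- zeta))%:E * inter_execution_time f k c x)%E.
Proof.
move=> _ _ _ /standardP[rho ->] [_ F_homog] _ lambda x lambda0.
rewrite dilation_const powRN; apply: inter_execution_time_rescale.
- by rewrite gt_eqF// powR_gt0.
- exact: powR_gt0.
(* The doubled exponent vector is again constant, so state and error are both scaled by the same
   [a], namely [lambda] to the power [rho]. *)
- by move=> v; have := F_homog lambda v lambda0;
  rewrite row_mx_const !dilation_const scalerA.
Qed.
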